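(* Assume there exist constants $K_{\partial\Omega,\Omega},K_1$ such that for every $f\in C^1(\Omega)$ $$\mathrm{Var}_{\lambda_{\partial\Omega}}(f)\le K_{\partial\Omega,\Omega}\int_\Omega|\nabla f|^2\,d\lambda_\Omega$$ and $$\Bigl(\int_\Omega f\,d\lambda_\Omega-\int_{\partial\Omega}f\,d\lambda_{\partial\Omega}\Bigr)^2\le K_1\int_\Omega|\nabla f|^2\,d\lambda_\Omega.$$ Then for every $\alpha\in(0,1)$ $$\hat C_\alpha\le C_\Omega+\frac{1-\alpha}{\alpha}K_{\partial\Omega,\Omega}+(1-\alpha)K_1.$$
   Context: $\Omega$ is a smooth compact connected Riemannian manifold of dimension $d\ge2$ with smooth connected boundary $\partial\Omega$. $\lambda_\Omega$ and $\lambda_{\partial\Omega}$ are the normalised volume measure on $\Omega$ and the normalised $(d-1)$-dimensional Hausdorff measure on $\partial\Omega$. For $\alpha\in(0,1)$, $\lambda_\alpha=\alpha\lambda_\Omega+(1-\alpha)\lambda_{\partial\Omega}$. $\mathrm{Var}_\mu(f)=\int f^2d\mu-(\int f\,d\mu)^2$. $C_\Omega$ is the (Neumann) Poincaré constant of $\Omega$, i.e. the optimal constant with $\mathrm{Var}_{\lambda_\Omega}(f)\le C_\Omega\int_\Omega|\nabla f|^2d\lambda_\Omega$ for all $f\in C^1(\Omega)$. The Poincaré constant for Brownian motion with sticky reflection (without boundary diffusion) is $$\hat C_\alpha=\sup_{f\in C^1(\Omega),\ \hat{\mathcal E}_\alpha(f)>0}\frac{\mathrm{Var}_{\lambda_\alpha}(f)}{\hat{\mathcal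 E}_\alpha(f)},\qquad\hat{\mathcal E}_\alpha(f)=\alpha\int_\Omega|\nabla f|^2\,d\lambda_\Omega.$$ *)

(* Defs.v *)
From HB Require Import structures.
From mathcomp Require Import all_boot all_order all_algebra.
From mathcomp Require Import all_classical all_reals all_analysis.

Set Implicit Arguments.
Unset Strict Implicit.
Unset Printing Implicit Defensive.

Import Order.TTheory GRing.Theory Num.Theory.
Import numFieldNormedType.Exports.

Local Open Scope classical_set_scope.
Local Open Scope ring_scope.

(* Manifolds with boundary are modelled on the half-space {x | 0 <= x_0} of
   R^(n+1); the dimension is written n.+1 throughout, so that the boundary has
   dimension n. *)

Section HalfSpaceCalculus.
Context {R : realType} {n : nat}.
Local Notation E := 'rV[R]_n.+1.

Definition halfspace : set E := [set x | 0 <= x ord0 ord0].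

Definition relatively_open (W : set E) : Prop :=
  exists2 V : set E, open V & W = V `&` halfspace.

Definition basis_vec (k : 'I_n.+1) : E := delta_mx ord0 k.

(* F is of class C^m on the open set V. *)
Fixpoint Ck (m : nat) (V : set E) (F : E -> R) : Prop :=
  (forall x, V x -> {for x, continuous F}) /\
  (if m is m'.+1 then
     forall k, (forall x, V x -> derivable F x (basis_vec k)) /\
               Ck m' V (fun x => 'D_(basis_vec k) F x)
   else True).

(* On a subset W of the half-space, regularity means the local existence of an
   extension to an open subset of R^(n+1) with that regularity. *)
Definition locally_extends (P : set E -> (E -> R) -> Prop)
    (W : set E) (f : E -> R) : Prop :=
  forall x, W x -> exists V F,
    [/\ open V, V x, P V F & forall y, V y -> W y -> F y = f y].

Definition C1_on := locally_extends (Ck 1).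
Definition smooth_on := locally_extends (fun V F => forall m, Ck m V F).

(* k-th partial derivative relative to the half-space: the usual one at interior
   points, and the one-sided one for k = 0 when x_0 = 0. *)
Definition pder (k : 'I_n.+1) (f : E -> R) (x : E) : R :=
  lim (h^-1 * (f (x + h *: basis_vec k) - f x)
       @[h --> within [set h | halfspace (x + h *: basis_vec k)] 0^']).

End HalfSpaceCalculus.

(* Lebesgue integral over R^m of a nonnegative Borel function, as an iterated
   integral (Tonelli). *)
Fixpoint lebint {R : realType} (m : nat) : ('rV[R]_m -> \bar R) -> \bar R :=
  match m with
  | 0 => fun f => f 0
  | m'.+1 => fun f =>
      (\int[lebesgue_measure]_t
         lebint (fun v : 'rV[R]_m' => f (row_mx (t%:M : 'rV[R]_1) v)))%E
  end.

(* Structure of smooth Riemannian manifold with (possibly empty) boundary on the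
   space T, given by a smooth atlas and the matrices of the metric tensor in the
   charts. *)
Record riemannianManifold (R : realType) (n : nat) (T : ptopologicalType) := {
  chart : Type;
  dom : chart -> set T;
  coord : chart -> T -> 'rV[R]_n.+1;
  uncoord : chart -> 'rV[R]_n.+1 -> T;
  chart_at : T -> chart;
  metric : chart -> 'rV[R]_n.+1 -> 'M[R]_n.+1;
  dom_open : forall i, open (dom i);
  dom_chart_at : forall p, dom (chart_at p) p;
  codom_open : forall i, relatively_open (coord i @` dom i);
  coordK : forall i p, dom i p -> uncoord i (coord i p) = p;
  coord_continuous : forall i, {within dom i, continuous (coord i)};
  uncoord_continuous : forall i,
    {within coord i @` dom i, continuous (uncoord i)};
  transition_smooth : forall i j k,
    smooth_on (coord i @` (dom i `&` dom j))
              (fun x => coord j (uncoord i x) ord0 k);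
  metric_smooth : forall i k l,
    smooth_on (coord i @` dom i) (fun x => metric i x k l);
  metric_sym : forall i p, dom i p ->
    (metric i (coord i p))^T = metric i (coord i p);
  metric_posdef : forall i p (v : 'rV[R]_n.+1), dom i p -> v != 0 ->
    0 < (v *m metric i (coord i p) *m v^T) ord0 ord0;
  metric_tensor : forall i j p, dom i p -> dom j p ->
    let J := \matrix_(k, l)
      pder k (fun x => coord j (uncoord i x) ord0 l) (coord i p) in
    metric i (coord i p) = J *m metric j (coord j p) *m J^T
}.

Section Riemannian.
Context {R : realType} {n : nat} {T : ptopologicalType}.
Variable M : riemannianManifold R n T.

Definition mboundary : set T :=
  [set p | exists2 i : chart M, dom i p & coord i p ord0 ord0 = 0].

Definition C1 (f : T -> R) : Prop :=
  forall i : chart M, C1_on (coord i @` dom i) (f \o uncoord i).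

(* Tangent vectors at p are represented by their components in chart_at M p. *)
Definition metric_at (p : T) : 'M[R]_n.+1 :=
  metric (chart_at M p) (coord (chart_at M p) p).

Definition sqnorm_at (p : T) (v : 'rV[R]_n.+1) : R :=
  (v *m metric_at p *m v^T) ord0 ord0.

Definition grad (f : T -> R) (p : T) : 'rV[R]_n.+1 :=
  (\row_k pder k (f \o uncoord (chart_at M p)) (coord (chart_at M p) p))
    *m invmx (metric_at p).

Definition sqnorm_grad (f : T -> R) (p : T) : R := sqnorm_at p (grad f p).

(* Continuous curves [0, 1] -> T that are C^1 off a finite set of times. *)
Definition piecewise_C1 (c : R -> T) : Prop :=
  {within `[0, 1], continuous c} /\
  exists2 S : set R, finite_set S &
    forall t, 0 < t < 1 -> ~ S t -> forall i : chart M, dom i (c t) ->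
      derivable (coord i \o c) t 1 /\
      {for t, continuous (derive1 (coord i \o c))}.

Definition speed (c : R -> T) (t : R) : R :=
  Num.sqrt (sqnorm_at (c t) (derive1 (coord (chart_at M (c t)) \o c) t)).

Definition curve_length (c : R -> T) : \bar R :=
  (\int[lebesgue_measure]_(t in `[0%R, 1%R]) (speed c t)%:E)%E.

Definition rdist (p q : T) : \bar R :=
  ereal_inf [set curve_length c | c in
    [set c | [/\ piecewise_C1 c, c 0 = p & c 1 = q]]].

Definition diam (A : set T) : \bar R :=
  ereal_sup (0%E |` [set rdist p q | p in A & q in A]).

(* s-dimensional Hausdorff measure for the Riemannian distance, s >= 1, without
   the dimensional constant, which is irrelevant after normalisation. *)
Definition hausdorff (s : nat) (A : set T) : \bar R :=
  ereal_sup [set ereal_inf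
      [set (\sum_(0 <= k <oo) diam (C k) ^+ s)%E | C in
        [set C : nat -> set T | A `<=` \bigcup_k C k /\
          forall k, (diam (C k) <= delta%:E)%E]]
    | delta in [set delta : R | 0 < delta]].

Definition borel : Type := g_sigma_algebraType (@open T).

(* The measure with density sqrt(det g) with respect to Lebesgue in charts. *)
Definition is_riemannian_volume (vol : {measure set borel -> \bar R}) : Prop :=
  forall (i : chart M) (A : set borel), measurable A -> A `<=` dom i ->
    vol A = lebint (fun x =>
      (\1_(coord i @` A) x * Num.sqrt (\det (metric i x)))%:E).

Definition is_normalisation (mu : set borel -> \bar R)
    (P : probability borel R) : Prop :=
  (0 < mu setT < +oo)%E /\
  forall A, measurable A -> (P A * mu setT = mu A)%E.

Definition is_normalised_volume (P : probability borel R) : Prop :=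
  exists2 vol : {measure set borel -> \bar R},
    is_riemannian_volume vol & is_normalisation vol P.

Definition is_normalised_boundary_measure (P : probability borel R) : Prop :=
  is_normalisation (fun A => hausdorff n (A `&` mboundary)) P.

Definition mixture (alpha : R) (halpha : 0 < alpha < 1)
    (P Q : {measure set borel -> \bar R}) : {measure set borel -> \bar R} :=
  measure_add
    (mscale (NngNum (ltW (proj1 (andP halpha)))) P)
    (mscale (NngNum (etrans (subr_ge0 alpha 1) (ltW (proj2 (andP halpha))))) Q).

Definition Var (mu : {measure set borel -> \bar R}) (f : T -> R) : R :=
  \int[mu]_x (f x ^+ 2) - (\int[mu]_x f x) ^+ 2.

(* Integral of |grad f|^2; it is finite for C^1 functions on a compact manifold,
   so that taking it in R is harmless. *)
Definition dirichlet (lamO : {measure set borel -> \bar R}) (f : T -> R) : R :=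
  \int[lamO]_x sqnorm_grad f x.

Definition poincare_const (lamO : {measure set borel -> \bar R}) : \bar R :=
  ereal_inf [set C%:E | C in
    [set C : R | forall f, C1 f -> Var lamO f <= C * dirichlet lamO f]].

Definition sticky_energy (alpha : R) (lamO : {measure set borel -> \bar R})
    (f : T -> R) : R := alpha * dirichlet lamO f.

Definition sticky_poincare_const (alpha : R) (halpha : 0 < alpha < 1)
    (lamO lamB : {measure set borel -> \bar R}) : \bar R :=
  ereal_sup [set (Var (mixture halpha lamO lamB) f
                    / sticky_energy alpha lamO f)%:E | f in
    [set f | C1 f /\ 0 < sticky_energy alpha lamO f]].

End Riemannian.

Arguments borel : clear implicits.

(* Main.v *)
Require Import Defs.
From HB Require Import structures.
From mathcomp Require Import all_boot all_order all_algebra.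
From mathcomp Require Import all_classical all_reals all_analysis.
From mathcomp Require Import measurable_realfun ring.
Import Order.TTheory GRing.Theory Num.Theory.
Import numFieldNormedType.Exports.
Local Open Scope classical_set_scope.
Local Open Scope ring_scope.

(** The variance of a mixture splits into the two variances and the squared
    distance of the two means:
      Var_(a P + (1 - a) Q) f
        = a Var_P f + (1 - a) Var_Q f + a (1 - a) (E_P f - E_Q f)^2
    ([Var_mixture]). For P the volume and Q the boundary measure, each of the
    three terms is controlled by the Dirichlet energy D of f: the first by any
    admissible Poincare constant C, the other two by the assumed inequalities
    with K and K1. Dividing by the sticky energy a D bounds the quotient of f by
      C + (1 - a) / a K + (1 - a) K1,
    and it remains to take the infimum over C and the supremum over f.

    The splitting is an identity between real-valued integrals, and holds
    because f and f^2 are integrable for both measures: a C^1 function, given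
    only through local extensions in charts, is continuous ([C1_continuous]),
    hence Borel and bounded on a compact space
    ([continuous_compact_borel_integrable]). *)

Lemma continuous_borel_measurable (R : realType) (T : ptopologicalType)
    (f : T -> R) : continuous f -> measurable_fun setT (f : borel T -> R).
Proof.
move=> /continuousP cf; apply: (measurability _ (RGenOpens.measurableE R)).
move=> _ [_ [x [y ->]] <-]; rewrite setTI.
by apply: sub_sigma_algebra; apply: cf; exact: interval_open.
Qed.

Lemma continuous_compact_borel_integrable (R : realType) (T : ptopologicalType)
    (P : probability (borel T) R) (f : T -> R) :
  compact [set: T] -> continuous f ->
  P.-integrable setT (EFin \o (f : borel T -> R)).
Proof.
move=> cT cf; apply: measurable_bounded_integrable => //.
- by apply: (@le_lt_trans _ _ 1%E); [exact: probability_le1|exact: ltry].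
- exact: continuous_borel_measurable.
have /compact_bounded [M [Mr fM]] : compact (f @` [set: T]).
  by apply: continuous_compact => //; exact: continuous_subspaceT.
by exists M; split => // N MN x _; apply: (fM N MN); exists x.
Qed.

(** Near p, f is the composition of the chart at p with a continuous extension
    F of its coordinate expression; as the domain of the chart is open, relative
    continuity of the chart there is continuity at p. *)
Lemma C1_continuous {R : realType} {n : nat} {T : ptopologicalType}
    {M : riemannianManifold R n T} {f : T -> R} : C1 M f -> continuous f.
Proof.
move=> fC1 p; set i := chart_at M p.
have ip : dom i p := dom_chart_at M p.
have cp : {for p, continuous (Defs.coord i)}.
  have := @Defs.coord_continuous _ _ _ M i.
  rewrite (continuous_open_subspace _ (@dom_open _ _ _ M i)).
  by apply; rewrite inE.
have [|V [F [oV Vp [cF _] Ff]]] := fC1 i (Defs.coord i p); first by exists p.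
have fE : \near p, F (Defs.coord i p) = f p.
  have nV : \forall q \near p, V (Defs.coord i q).
    by apply: cp; exact: open_nbhs_nbhs.
  have nD : \forall q \near p, dom i q.
    by apply: open_nbhs_nbhs; split => //; exact: dom_open.
  near=> q; rewrite Ff /=.
  - by rewrite coordK//; near: q.
  - by near: q.
  - by exists q => //; near: q.
rewrite /continuous_at -(nbhs_singleton fE).
apply: cvg_trans (near_eq_cvg fE) _.
by apply: (@cvg_comp _ _ _ (Defs.coord i) F) ; [exact: cp|exact: cF].
Unshelve. all: by end_near. Qed.

Section mscale.
Local Open Scope ereal_scope.
Context d (T : measurableType d) (R : realType).
Variables (mu : {measure set T -> \bar R}) (k : {nonneg R}).

Lemma integrable_mscale (f : T -> \bar R) :
  mu.-integrable setT f -> (mscale k mu).-integrable setT f.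
Proof.
move=> /integrableP[mf foo]; apply/integrableP; split => //.
rewrite ge0_integral_mscale//; last exact: measurableT_comp.
by rewrite lte_mul_pinfty// ?lee_fin.
Qed.

Lemma integral_mscale (f : T -> \bar R) : mu.-integrable setT f ->
  \int[mscale k mu]_x f x = k%:num%:E * \int[mu]_x f x.
Proof.
move=> fi; have /integrableP[mf _] := fi.
rewrite (integralE (mscale k mu)) (integralE mu) !ge0_integral_mscale//.
- by rewrite (muleBr _ (integrable_add_def measurableT fi)).
- exact: measurable_funeneg.
- exact: measurable_funepos.
Qed.

End mscale.

Section mixture_integral.
Context (R : realType) (T : ptopologicalType).
Variables (P Q : {measure set (borel T) -> \bar R}).
Variables (a : R) (ha : 0 < a < 1).

Lemma Rintegral_mixture (f : borel T -> R) :
  P.-integrable setT (EFin \o f) -> Q.-integrable setT (EFin \o f) ->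
  \int[mixture ha P Q]_x f x = a * \int[P]_x f x + (1 - a) * \int[Q]_x f x.
Proof.
move=> fP fQ; rewrite /Rintegral /mixture.
rewrite integral_measure_add//; [|exact: integrable_mscale..].
rewrite !integral_mscale// fineD ?fin_numM ?integrable_fin_num//.
by rewrite !fineM// integrable_fin_num.
Qed.

Lemma Var_mixture (f : T -> R) :
  P.-integrable setT (EFin \o (f : borel T -> R)) ->
  Q.-integrable setT (EFin \o (f : borel T -> R)) ->
  P.-integrable setT (EFin \o ((fun x => f x ^+ 2) : borel T -> R)) ->
  Q.-integrable setT (EFin \o ((fun x => f x ^+ 2) : borel T -> R)) ->
  Var (mixture ha P Q) f = a * Var P f + (1 - a) * Var Q f
    + a * (1 - a) * (\int[P]_x f x - \int[Q]_x f x) ^+ 2.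
Proof. by move=> fP fQ f2P f2Q; rewrite /Var !Rintegral_mixture//; ring. Qed.

End mixture_integral.

Theorem proposition3p1 (R : realType) (n : nat) (hn : (2 <= n.+1)%N)
  (T : ptopologicalType) (M : riemannianManifold R n T)
  (T_hausdorff : hausdorff_space T)
  (T_compact : compact [set: T])
  (T_connected : connected [set: T])
  (bd_nonempty : mboundary M !=set0)
  (bd_connected : connected (mboundary M))
  (lamO lamB : probability (borel T) R)
  (lamO_volume : is_normalised_volume M lamO)
  (lamB_boundary : is_normalised_boundary_measure M lamB)
  (K K1 : R)
  (hK : forall f, C1 M f -> Var lamB f <= K * dirichlet M lamO f)
  (hK1 : forall f, C1 M f ->
    (\int[lamO]_x f x - \int[lamB]_x f x) ^+ 2 <= K1 * dirichlet M lamO f)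
  (alpha : R) (halpha : 0 < alpha < 1) :
  (sticky_poincare_const M halpha lamO lamB <=
     poincare_const M lamO
     + ((1 - alpha) / alpha * K)%:E + ((1 - alpha) * K1)%:E)%E.
Proof.
have [a0 a1] := andP halpha.
apply/ereal_supP => _ [f [fC1 energy0] <-].
(* Moving the real constants to the left leaves the infimum alone on the right,
   so that it may be infinite. *)
rewrite -addeA -EFinD -leeBlDr//.
apply/ereal_infP => _ [C CP <-].
have D0 : 0 < dirichlet M lamO f by rewrite -(pmulr_rgt0 _ a0).
rewrite leeBlDr// -EFinD lee_fin ler_pdivrMr//.
have cf := C1_continuous fC1.
have cf2 : continuous (fun x => f x ^+ 2).
  move=> x; apply: (@continuous_comp _ _ _ f (fun y => y ^+ 2)); first exact: cf.
  exact: exprn_continuous.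
rewrite Var_mixture; try exact: continuous_compact_borel_integrable.
rewrite /sticky_energy.
have := CP f fC1; have := hK f fC1; have := hK1 f fC1.
set D := dirichlet _ _ _ in D0 *.
move=> h1 hB hO.
have -> : (C + ((1 - alpha) / alpha * K + (1 - alpha) * K1)) * (alpha * D) =
    alpha * (C * D) + (1 - alpha) * (K * D) + alpha * (1 - alpha) * (K1 * D).
  by field; rewrite gt_eqF.
by rewrite !lerD// ler_wpM2l// ?mulr_ge0// ?subr_ge0 ltW.
Qed.
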